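(* Let $n\ge 1$ and let $(\{v_j\},\{p_j\})$ be a sequential norming pair for $\mathbb{R}^n$ such that $$p_j\left\lfloor\frac{\|v_{j+1}\|}{\|v_j\|}-1\right\rfloor\ge 1\quad\text{for all but finitely many } j,$$ and let $(G_v,\sigma_v)$ be the topological group generated by $(\{v_j\},\{p_j\})$. Then the completion $\mathcal{C}(G_v,\sigma_v)$ is one dimensional, locally totally disconnected, and not locally compact.
   Context: All sequences are indexed by $\mathbb{N}=\{1,2,\dots\}$, and $\lfloor x\rfloor$ is the greatest integer less than or equal to $x$. A sequential norming pair (SNP) for $\mathbb{R}^n$ is a pair $(\{v_j\},\{p_j\})$ where $\{p_j\}$ is a nonincreasing sequence of positive real numbers converging to $0$, and $\{v_j\}$ is a sequence in $\mathbb{R}^n\setminus\{0\}$ such that $\{\|v_j\|\}$ (Euclidean norm) is nondecreasing and $\{p_{j+1}\|v_{j+1}\|/\|v_j\|\}$ has a positive lower bound. The topological group generated by an SNP $(\{v_j\},\{p_j\})$ is $(G_v,\sigma_v)$, where $G_v$ is the subgroup of $\mathbb{R}^n$ generated by $\{v_j\}$ and $\sigma_v(x)=\inf\{\sum |c_j|p_j : x=\sum c_jv_j,\ c_j\in\mathbb{Z}\}$ (finite sums). $\sigma_v$ induces the translation-invariant metric $d(x,y)=\sigma_v(x-y)$ and a metrizable group topology on $G_v$ (known). $\mathcal{C}(G_v,\sigma_v)$ is the completion of $G_v$ as a metric space for $d$, with the group operations extended continuously. These groups are separable metrizable, so all standard dimension functions (small inductive, large inductive, covering) agree; ''dimension''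 means any of them. A space is totally disconnected if its components are points; a topological group is locally totally disconnected if the identity has a totally disconnected neighborhood. *)

(* Defs.v *)
From HB Require Import structures.
From mathcomp Require Import all_boot all_order all_algebra.
From mathcomp Require Import generic_quotient ring_quotient.
From mathcomp Require Import all_classical all_reals all_analysis.

Set Implicit Arguments.
Unset Strict Implicit.
Unset Printing Implicit Defensive.

Import Order.TTheory GRing.Theory Num.Theory.
Import numFieldNormedType.Exports.

Local Open Scope classical_set_scope.
Local Open Scope ring_scope.

(** * Completion of an abelian group for an invariant pseudometric *)

(* A seminorm N on an abelian group: d(x, y) = N (x - y) is then a
   translation-invariant pseudometric.  Definiteness is not required: the
   completion below identifies the points at distance 0. *)
Record group_seminorm (R : realType) (G : zmodType) := GroupSeminorm {
  gsnorm :> G -> R ;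
  gsnorm_0 : gsnorm 0 = 0 ;
  gsnorm_N : forall x, gsnorm (- x) = gsnorm x ;
  gsnorm_D : forall x y, gsnorm (x + y) <= gsnorm x + gsnorm y }.

Section GroupCompletion.
Variables (R : realType) (G : zmodType) (N : group_seminorm R G).

Definition gcauchy (u : nat -> G) : Prop := forall e : R, 0 < e ->
  exists K, forall i j, (K <= i)%N -> (K <= j)%N -> N (u i - u j) < e.

Definition gcauchy_pred : {pred nat -> G} := [pred u | `[< gcauchy u >]].

Lemma gsnorm_ge0 x : 0 <= N x.
Proof.
have := gsnorm_D N x (- x).
by rewrite subrr gsnorm_0 gsnorm_N -mulr2n pmulrn_lge0.
Qed.

Lemma gsnorm_B x y : N (x - y) <= N x + N y.
Proof. by rewrite (le_trans (gsnorm_D _ _ _))// gsnorm_N. Qed.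

Lemma gsnorm_sym x y : N (x - y) = N (y - x).
Proof. by rewrite -gsnorm_N opprB. Qed.

Lemma gcauchy_zmod : zmod_closed gcauchy_pred.
Proof.
split => [|u w /asboolP cu /asboolP cw]; apply/asboolP => e e0.
  by exists 0%N => i j _ _; rewrite subrr gsnorm_0.
have e20 : 0 < e / 2 by rewrite divr_gt0.
have [K HK] := cu _ e20; have [L HL] := cw _ e20.
exists (maxn K L) => i j; rewrite !geq_max => /andP[Ki Li] /andP[Kj Lj].
have -> : (u - w) i - (u - w) j = (u i - u j) - (w i - w j).
  change (u i - w i - (u j - w j) = (u i - u j) - (w i - w j)).
  by rewrite !opprB [w j - u j]addrC addrACA [- w i + _]addrC.
rewrite (le_lt_trans (gsnorm_B _ _))//.
by rewrite [e]splitr ltrD// ?HK// HL.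
Qed.

HB.instance Definition _ :=
  GRing.isZmodClosed.Build (nat -> G) gcauchy_pred gcauchy_zmod.

Record cauchy_sequence := CauchySequence {
  cseq :> nat -> G ; cseq_cauchy : cseq \in gcauchy_pred }.

HB.instance Definition _ := [isSub for cseq].
HB.instance Definition _ := [Choice of cauchy_sequence by <:].
HB.instance Definition _ := [SubChoice_isSubZmodule of cauchy_sequence by <:].

Lemma cseq0 k : cseq 0 k = 0. Proof. by []. Qed.
Lemma cseqN u k : cseq (- u) k = - u k. Proof. by []. Qed.
Lemma cseqD u w k : cseq (u + w) k = u k + w k. Proof. by []. Qed.
Lemma cseqB u w k : cseq (u - w) k = u k - w k. Proof. by []. Qed.

Definition gnull_pred : {pred cauchy_sequence} :=
  [pred u | `[< N (cseq u k) @[k --> \oo] --> (0 : R) >]].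

Lemma gnull_zmod : zmod_closed gnull_pred.
Proof.
split => [|u w /asboolP cu /asboolP cw]; apply/asboolP => /=.
  rewrite (_ : (fun _ => _) = fun=> 0); first exact: cvg_cst.
  by apply/funext => k; exact: (gsnorm_0 N).
have H : (fun k => N (u k) + N (w k)) @ \oo --> (0 : R).
  by rewrite -[0]addr0; exact: cvgD.
apply: (squeeze_cvgr _ (cvg_cst 0) H); near=> k.
by rewrite gsnorm_ge0/=; exact: gsnorm_B.
Unshelve. all: by end_near. Qed.

HB.instance Definition _ :=
  GRing.isZmodClosed.Build cauchy_sequence gnull_pred gnull_zmod.

Lemma gsnorm_dist x y : `|N x - N y| <= N (x - y).
Proof.
rewrite ler_norml lerBlDr lerNl opprB lerBlDr; apply/andP; split.
  by rewrite gsnorm_sym (le_trans _ (gsnorm_D _ _ _))// subrK.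
by rewrite (le_trans _ (gsnorm_D _ _ _))// subrK.
Qed.

Definition cseq_norm (u : cauchy_sequence) : R := lim (N (u k) @[k --> \oo]).

Lemma cseq_norm_cvg u : N (cseq u k) @[k --> \oo] --> cseq_norm u.
Proof.
apply/cauchy_cvgP/cauchy_exP => e e0.
have /asboolP HK := cseq_cauchy u.
have [L HL] := HK _ e0.
exists (N (u L)), L => // j /= Lj.
by rewrite /ball/= (le_lt_trans (gsnorm_dist _ _))// HL.
Qed.

Lemma cseq_norm_ge0 u : 0 <= cseq_norm u.
Proof.
rewrite /cseq_norm; apply: limr_ge; first exact: (cvgP _ (@cseq_norm_cvg u)).
by near=> k; exact: gsnorm_ge0.
Unshelve. all: by end_near. Qed.

Lemma eq_cseq_lim (f g : nat -> R) : f =1 g -> lim (f @ \oo) = lim (g @ \oo).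
Proof. by move=> /funext ->. Qed.

Lemma cseq_normN u : cseq_norm (- u) = cseq_norm u.
Proof.
rewrite /cseq_norm; apply: eq_cseq_lim => k; exact: gsnorm_N.
Qed.

Lemma cseq_normD u w : cseq_norm (u + w) <= cseq_norm u + cseq_norm w.
Proof.
have uw : (fun k => N (u k) + N (w k)) @ \oo --> cseq_norm u + cseq_norm w.
  by apply: cvgD; exact: cseq_norm_cvg.
apply: (@ler_cvg_to _ \oo _ R _ _ _ _ (@cseq_norm_cvg (u + w)) uw).
by near=> k; exact: gsnorm_D.
Unshelve. all: by end_near. Qed.

Lemma cseq_norm_eq0 u : (u \in gnull_pred) <-> cseq_norm u = 0.
Proof.
split => [/asboolP u0|u0]; first by apply: cvg_lim.
by apply/asboolP; rewrite -u0; exact: cseq_norm_cvg.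
Qed.

(* Cauchy sequences modulo null sequences, with the quotient group structure. *)
Definition completion : Type := {ideal_quot gnull_pred}.

HB.instance Definition _ := GRing.Zmodule.on completion.

Definition completion_class (u : cauchy_sequence) : completion :=
  \pi_({ideal_quot gnull_pred})%qT u.

Lemma completion_classB u w :
  completion_class (u - w) = completion_class u - completion_class w.
Proof. by rewrite /completion_class raddfB. Qed.

(* The continuous extension of N to the completion. *)
Definition completion_norm (x : completion) : R := cseq_norm (repr x).

Lemma completion_normE u : completion_norm (completion_class u) = cseq_norm u.
Proof.
have null0 w : w \in gnull_pred -> cseq_norm w = 0 by move/cseq_norm_eq0.
rewrite /completion_norm; set w := repr _.
have uw : cseq_norm (u - w) = 0.
  apply: null0; rewrite Quotient.idealrBE.
  by rewrite /w reprK.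
apply/eqP; rewrite eq_le; apply/andP; split.
  rewrite -[w](subrK u) (le_trans (cseq_normD _ _))//.
  by rewrite -opprB cseq_normN uw add0r.
by rewrite -{1}[u](subrK w) (le_trans (cseq_normD _ _))// uw add0r.
Qed.

Lemma completion_normN x : completion_norm (- x) = completion_norm x.
Proof.
have -> : x = completion_class (repr x) by rewrite /completion_class reprK.
rewrite -[- _]add0r -(subrr (completion_class (repr x))) -!completion_classB.
by rewrite !completion_normE subrr add0r cseq_normN.
Qed.

Lemma completion_classP (x : completion) : exists u, x = completion_class u.
Proof. by exists (repr x); rewrite /completion_class reprK. Qed.

Definition completion_dist (x y : completion) : R := completion_norm (x - y).

Lemma completion_distE u w : completion_dist (completion_class u)
  (completion_class w) = lim (N (u k - w k) @[k --> \oo]).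
Proof.
rewrite /completion_dist -completion_classB completion_normE.
exact: eq_cseq_lim.
Qed.

Lemma completion_dist_xx x : completion_dist x x = 0.
Proof.
have [u ->] := completion_classP x.
rewrite completion_distE (_ : (fun _ => _) = fun=> 0) ?lim_cst//.
by apply/funext => k; rewrite subrr gsnorm_0.
Qed.

Lemma completion_dist_positivity x y : completion_dist x y = 0 -> x = y.
Proof.
have [u ->] := completion_classP x; have [w ->] := completion_classP y.
rewrite /completion_dist -completion_classB completion_normE.
move=> /cseq_norm_eq0; rewrite Quotient.idealrBE => /eqP.
exact.
Qed.

Lemma completion_dist_sym x y : completion_dist x y = completion_dist y x.
Proof.
have [u ->] := completion_classP x; have [w ->] := completion_classP y.
by rewrite /completion_dist -!completion_classB !completion_normE
  -cseq_normN opprB.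
Qed.

Lemma completion_dist_triangle y x z :
  completion_dist x z <= completion_dist x y + completion_dist y z.
Proof.
have [u ->] := completion_classP x; have [w ->] := completion_classP y.
have [t ->] := completion_classP z.
rewrite /completion_dist -!completion_classB !completion_normE.
by rewrite (le_trans _ (cseq_normD _ _))// addrA subrK.
Qed.

HB.instance Definition _ := @isMetric.Build R completion completion_dist
  completion_dist_xx completion_dist_positivity completion_dist_sym
  completion_dist_triangle.

Lemma completion_sub_continuous :
  continuous (fun x : completion * completion => x.1 - x.2).
Proof.
move=> [x y]; apply/(@metricType_numDomainType.cvgrPdist_lt R) => e e0.
have e20 : 0 < e / 2 by rewrite divr_gt0.
exists (ball x (e / 2), ball y (e / 2)); first by split; exact: nbhsx_ballx.
move=> [x' y'] /=; rewrite !ballEmdist /= => -[xx' yy'].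
rewrite [e]splitr (le_lt_trans _ (ltrD xx' yy'))//.
rewrite (le_trans (completion_dist_triangle (x' - y) _ _))//.
rewrite /mdist /= /completion_dist lerD//.
  by rewrite opprB addrA subrK.
by rewrite [_ - _ - _](_ : _ = - (y - y')) ?completion_normN// !opprB addrC
  addrA subrK.
Qed.

HB.instance Definition _ :=
  PreTopologicalNmodule_isTopologicalZmodule.Build completion
    completion_sub_continuous.

Lemma const_gcauchy (x : G) : (fun=> x) \in gcauchy_pred.
Proof.
by apply/asboolP => e e0; exists 0%N => i j _ _; rewrite subrr gsnorm_0.
Qed.

Definition completion_embed (x : G) : completion :=
  completion_class (CauchySequence (const_gcauchy x)).

Lemma completion_embedB x y :
  completion_embed (x - y) = completion_embed x - completion_embed y.
Proof.
by rewrite -completion_classB; congr completion_class; exact: val_inj.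
Qed.

Lemma completion_embed_isometry x y :
  mdist (completion_embed x) (completion_embed y) = N (x - y).
Proof. by rewrite /mdist/= completion_distE/= lim_cst. Qed.

Lemma completion_embed_approx (u : cauchy_sequence) (e : R) : 0 < e ->
  exists K, forall k, (K <= k)%N ->
    mdist (completion_embed (u k)) (completion_class u) <= e.
Proof.
move=> e0; have /asboolP/(_ _ e0)[K HK] := cseq_cauchy u.
exists K => k Kk; rewrite /mdist/= completion_distE.
have := @cseq_norm_cvg (CauchySequence (const_gcauchy (u k)) - u).
move=> /cvgP cu; apply: limr_le; first exact: cu.
by exists K => // j /= Kj; rewrite ltW// HK.
Qed.

Lemma completion_embed_dense : dense (range completion_embed).
Proof.
move=> U [x Ux] oU; have : nbhs x U by exact: open_nbhs_nbhs.
have [u xE] := completion_classP x.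
move=> /(@metricType_numDomainType.nbhs_mdistP R)[e /= e0 xeU].
have e20 : 0 < e / 2 by rewrite divr_gt0.
have [K HK] := completion_embed_approx u e20.
exists (completion_embed (u K)); split; last by exists (u K).
apply: xeU => /=; rewrite metric_sym xE (le_lt_trans (HK _ (leqnn K)))//.
by rewrite ltr_pdivrMr// ltr_pMr// ltr1n.
Qed.

HB.instance Definition _ := isPointed.Build completion 0.

Lemma completion_cauchy_cvg (F : set_system completion) :
  ProperFilter F -> cauchy F -> cvg F.
Proof.
move=> PF /cauchyP Fc.
have /choice[x Fx] k :
    exists g : G, F (ball (completion_embed g) (k.+1%:R^-1 : R)).
  have e20 : 0 < (k.+1%:R^-1 : R) / 2 by rewrite divr_gt0.
  have [y Fy] := Fc _ e20.
  have [u yE] := completion_classP y.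
  have [K /(_ K (leqnn K)) HK] := completion_embed_approx u e20.
  exists (u K); apply: filterS Fy => z; rewrite !ballEmdist /= => yz.
  rewrite (le_lt_trans (metric_triangle _ y _))//.
  by rewrite [ltRHS]splitr ler_ltD// yE.
have cx : gcauchy x.
  move=> e e0; have e20 : 0 < e / 2 by rewrite divr_gt0.
  have [K _ HK] := near_infty_natSinv_lt (PosNum e20).
  exists K => i j Ki Kj; rewrite -completion_embed_isometry.
  have : exists z, (ball (completion_embed (x i)) (i.+1%:R^-1 : R) `&`
      ball (completion_embed (x j)) (j.+1%:R^-1 : R)) z.
    by apply: (@filter_ex _ F); apply: filterI; exact: Fx.
  move=> [z].
  rewrite !ballEmdist /= => -[iz jz].
  rewrite (le_lt_trans (metric_triangle _ z _))// [e]splitr.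
  rewrite [mdist z _]metric_sym ltrD//.
    by rewrite (lt_trans iz)//; exact: HK.
  by rewrite (lt_trans jz)//; exact: HK.
have cx' : `[< gcauchy x >] by exact/asboolP.
pose w := CauchySequence (cx' : x \in gcauchy_pred).
apply/cvg_ex; exists (completion_class w).
apply/(@metricType_numDomainType.fcvgrPdist_lt R) => e e0.
have e20 : 0 < e / 2 by rewrite divr_gt0.
have [K HK] := completion_embed_approx w e20.
have [L _ HL] := near_infty_natSinv_lt (PosNum e20).
apply: filterS (Fx (maxn K L)) => z; rewrite ballEmdist /= => xz.
rewrite (le_lt_trans (metric_triangle _ (completion_embed (x (maxn K L))) _))//.
rewrite [e]splitr ler_ltD//; first by rewrite metric_sym HK// leq_maxl.
by rewrite (lt_trans xz)//; apply: HL; exact: leq_maxr.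
Qed.

HB.instance Definition _ :=
  Uniform_isComplete.Build completion completion_cauchy_cvg.

End GroupCompletion.

(** * Groups generated by sequential norming pairs *)

Definition euclidean_norm (R : realType) (n : nat) (x : 'rV[R]_n) : R :=
  Num.sqrt (\sum_i x ord0 i ^+ 2).

(* Sequences are indexed from 0 instead of 1. *)
Record is_SNP (R : realType) (n : nat) (v : nat -> 'rV[R]_n) (p : nat -> R) :
    Prop := IsSNP {
  snp_p_gt0 : forall j, 0 < p j ;
  snp_p_nonincreasing : nonincreasing_seq p ;
  snp_p_cvg0 : p @ \oo --> (0 : R) ;
  snp_v_neq0 : forall j, v j != 0 ;
  snp_v_nondecreasing : nondecreasing_seq (fun j => euclidean_norm (v j)) ;
  snp_lower_bound : exists2 e : R, 0 < e &
    forall j, e <= p j.+1 * euclidean_norm (v j.+1) / euclidean_norm (v j) }.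

Section GeneratedGroup.
Variables (R : realType) (n : nat) (v : nat -> 'rV[R]_n).

(* A finite integer combination is given by arbitrary coefficients
   c : nat -> int and a bound m on the indices that are used. *)
Definition int_comb (m : nat) (c : nat -> int) : 'rV[R]_n :=
  \sum_(j < m) v j *~ c j.

Definition generated_pred : {pred 'rV[R]_n} :=
  [pred x | `[< exists m c, x = int_comb m c >]].

Lemma int_comb_widen m m' c : (m <= m')%N ->
  int_comb m c = int_comb m' (fun j => if (j < m)%N then c j else 0).
Proof.
move=> mm'; rewrite /int_comb (big_ord_widen _ (fun j => v j *~ c j) mm').
rewrite big_mkcond; apply: eq_bigr => j _.
by case: ifP => // _; rewrite mulr0z.
Qed.

Lemma generated_zmod : zmod_closed generated_pred.
Proof.
split; first by apply/asboolP; exists 0%N, (fun=> 0); rewrite /int_comb big_ord0.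
move=> x y /asboolP[m [c ->]] /asboolP[k [d ->]]; apply/asboolP.
rewrite (int_comb_widen c (leq_maxl m k)) (int_comb_widen d (leq_maxr m k)).
exists (maxn m k), (fun j => (if (j < m)%N then c j else 0) -
                             (if (j < k)%N then d j else 0)).
rewrite /int_comb -sumrB.
by apply: eq_bigr => j _; rewrite mulrzBr.
Qed.

HB.instance Definition _ :=
  GRing.isZmodClosed.Build 'rV[R]_n generated_pred generated_zmod.

Lemma mem_generated j : v j \in generated_pred.
Proof.
apply/asboolP; exists j.+1, (fun i => (i == j)%:Z).
rewrite /int_comb big_ord_recr /= eqxx mulr1z big1 ?add0r// => i _.
by rewrite ltn_eqF.
Qed.

Lemma generated_smallest (S : zmodClosed 'rV[R]_n) :
  (forall j, v j \in S) -> {subset generated_pred <= S}.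
Proof.
move=> vS x /asboolP[m [c ->]]; apply: rpred_sum => j _.
by apply: rpredMz.
Qed.

Record generated_group := GeneratedGroup {
  generated_val :> 'rV[R]_n ; generated_valP : generated_val \in generated_pred }.

HB.instance Definition _ := [isSub for generated_val].
HB.instance Definition _ := [Choice of generated_group by <:].
HB.instance Definition _ := [SubChoice_isSubZmodule of generated_group by <:].

Variable p : nat -> R.

Definition int_comb_weight (m : nat) (c : nat -> int) : R :=
  \sum_(j < m) `|c j|%:~R * p j.

(* Only meaningful on the generated group: elsewhere this is inf set0 = 0. *)
Definition sigma (x : 'rV[R]_n) : R :=
  inf [set s | exists m c, x = int_comb m c /\ s = int_comb_weight m c].

Hypothesis vp : is_SNP v p.

Lemma int_comb_weight_ge0 m c : 0 <= int_comb_weight m c.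
Proof.
apply: sumr_ge0 => j _; rewrite mulr_ge0// ?ler0z//.
exact/ltW/(snp_p_gt0 vp).
Qed.

Lemma sigma_lbound x :
  lbound [set s | exists m c, x = int_comb m c /\ s = int_comb_weight m c] 0.
Proof. by move=> _ [m [c [_ ->]]]; exact: int_comb_weight_ge0. Qed.

Lemma sigma_le m c : sigma (int_comb m c) <= int_comb_weight m c.
Proof. by apply: ge_inf; [exists 0; exact: sigma_lbound|exists m, c]. Qed.

Lemma sigma_approx (x : generated_group) (e : R) : 0 < e -> exists m c,
  val x = int_comb m c /\ int_comb_weight m c < sigma (val x) + e.
Proof.
move=> e0; have /asboolP[m [c xE]] := generated_valP x.
have hi : has_inf [set s | exists m c,
    val x = int_comb m c /\ s = int_comb_weight m c].
  split; last by exists 0; exact: sigma_lbound.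
  by exists (int_comb_weight m c), m, c.
have [_ [k [d [xE' ->]]] lt] := inf_adherent e0 hi.
by exists k, d.
Qed.

Lemma sigma0 : sigma 0 = 0.
Proof.
apply/eqP; rewrite eq_le; apply/andP; split.
  have := sigma_le 0 (fun=> 0).
  by rewrite /int_comb /int_comb_weight !big_ord0.
apply: lb_le_inf; last exact: sigma_lbound.
by exists (int_comb_weight 0 (fun=> 0)), 0%N, (fun=> 0);
  rewrite /int_comb big_ord0.
Qed.

Lemma sigmaN x : sigma (- x) = sigma x.
Proof.
congr inf; apply/seteqP; split => s [m [c [xE ->]]];
  exists m, (fun j => - c j); split.
- rewrite -[x]opprK xE /int_comb -sumrN.
  by apply: eq_bigr => j _; rewrite mulrNz.
- by apply: eq_bigr => j _; rewrite normrN.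
- rewrite xE /int_comb -sumrN.
  by apply: eq_bigr => j _; rewrite mulrNz.
- by apply: eq_bigr => j _; rewrite normrN.
Qed.

Lemma int_comb_weight_widen m m' c : (m <= m')%N ->
  int_comb_weight m c =
  int_comb_weight m' (fun j => if (j < m)%N then c j else 0).
Proof.
move=> mm'; rewrite /int_comb_weight.
rewrite (big_ord_widen _ (fun j => `|c j|%:~R * p j) mm') big_mkcond.
by apply: eq_bigr => j _; case: ifP => // _; rewrite normr0 mul0r.
Qed.

Lemma sigmaD (x y : generated_group) :
  sigma (val x + val y) <= sigma (val x) + sigma (val y).
Proof.
apply/ler_addgt0Pr => e e0; have e20 : 0 < e / 2 by rewrite divr_gt0.
have [m [c [xE cx]]] := sigma_approx x e20.
have [k [d [yE dy]]] := sigma_approx y e20.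
rewrite [e]splitr addrACA (le_trans _ (lerD (ltW cx) (ltW dy)))// xE yE.
rewrite (int_comb_widen c (leq_maxl m k)) (int_comb_widen d (leq_maxr m k)).
rewrite (int_comb_weight_widen c (leq_maxl m k)).
rewrite (int_comb_weight_widen d (leq_maxr m k)).
move: (fun j => if (j < m)%N then c j else 0) => c'.
move: (fun j => if (j < k)%N then d j else 0) => d'.
have -> : int_comb (maxn m k) c' + int_comb (maxn m k) d' =
    int_comb (maxn m k) (fun j => c' j + d' j).
  by rewrite /int_comb -big_split; apply: eq_bigr => j _; rewrite mulrzDr.
rewrite (le_trans (sigma_le _ _))// -big_split ler_sum// => j _.
rewrite /= -mulrDl ler_wpM2r//; first exact/ltW/(snp_p_gt0 vp).
by rewrite -intrD ler_int ler_normD.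
Qed.

Definition sigma_seminorm : group_seminorm R generated_group :=
  @GroupSeminorm R generated_group (fun x => sigma (val x))
    sigma0 (fun x => sigmaN (val x)) sigmaD.

End GeneratedGroup.

(** * Dimension *)

(* [ind_lt k T] : the small inductive dimension of T is < k; the shift by one
   makes room for the empty space, of dimension -1. For open U, the frontier
   of U is [closure U `\` U], taken with the subspace topology. *)
Fixpoint ind_lt (k : nat) (T : topologicalType) : Prop :=
  match k with
  | 0 => [set: T] = set0
  | k.+1 => forall (x : T) (V : set T), open V -> V x -> exists U : set T,
      [/\ open U, U x, U `<=` V &
          ind_lt k (set_type (closure U `\` U))]
  end.

Definition ind_eq (n : nat) (T : topologicalType) : Prop :=
  ind_lt n.+1 T /\ ~ ind_lt n T.

Definition locally_totally_disconnected (G : topologicalZmodType) : Prop :=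
  exists2 U : set G, nbhs 0 U & totally_disconnected U.

(* Main.v *)
Require Import Defs.
From mathcomp Require Import all_boot all_order all_algebra.
From mathcomp Require Import all_classical all_reals all_analysis.
From mathcomp Require Import ring lra.

Import Order.TTheory GRing.Theory Num.Theory.
Import numFieldNormedType.Exports.

Local Open Scope classical_set_scope.
Local Open Scope ring_scope.

(** Close to 0, a combination [\sum_j c_j v_j] of small weight satisfies
    [|c_j| < 1 / p_j <= |v_{j+1}| / |v_j| - 1], so that its partial sums
    telescope to less than the next vector and its coefficients are unique.
    Hence a small ball of the completion is isometric to a ball of the integer
    sequences with [\sum_j |c_j| p_j] finite, a group of the kind of the
    complete Erdos space.  There
    - coordinates are locally constant and separate points;
    - spheres are zero-dimensional, since coordinatewise convergence together
      with equality of the norms gives convergence in the l1 metric;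
    - a bounded clopen neighbourhood of 0 is impossible (Erdos): moving along
      one coordinate after the other, by steps [p_j] as long as one stays inside,
      produces a convergent sequence of points at distance at most [p_j] from the
      complement;
    - the points [z_j v_j] with [z_j p_j] about [d / 2] are uniformly separated
      and stay in the ball of radius [d]. *)

(** * Euclidean norm: Cauchy-Schwarz and the triangle inequality *)

Section EuclideanNorm.
Context {R : realType} {n : nat}.
Implicit Types x y : 'rV[R]_n.

Lemma sqr_euclidean_norm x : euclidean_norm x ^+ 2 = \sum_i x ord0 i ^+ 2.
Proof. by rewrite sqr_sqrtr// sumr_ge0// => i _; rewrite sqr_ge0. Qed.

Lemma euclidean_norm_ge0 x : 0 <= euclidean_norm x.
Proof. exact: sqrtr_ge0. Qed.

Lemma euclidean_norm_gt0 x : x != 0 -> 0 < euclidean_norm x.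
Proof.
move=> x0; rewrite sqrtr_gt0 lt_neqAle sumr_ge0 ?andbT; last first.
  by move=> i _; rewrite sqr_ge0.
apply: contra_neq x0 => /esym/eqP; rewrite psumr_eq0; last first.
  by move=> i _; rewrite sqr_ge0.
move=> /allP x0; apply/rowP => i; rewrite mxE.
by have := x0 i (mem_index_enum _); rewrite sqrf_eq0 => /eqP.
Qed.

Lemma euclidean_norm0 : euclidean_norm (0 : 'rV[R]_n) = 0.
Proof.
by rewrite /euclidean_norm big1 ?sqrtr0// => i _; rewrite mxE expr0n.
Qed.

Lemma euclidean_normMz x (c : int) :
  euclidean_norm (x *~ c) = `|c|%:~R * euclidean_norm x.
Proof.
rewrite /euclidean_norm intr_norm -sqrtr_sqr -sqrtrM ?sqr_ge0// mulr_sumr.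
by congr Num.sqrt; apply: eq_bigr => i _; rewrite -scaler_int mxE exprMn.
Qed.

(** Summing [(b x_i - a y_i)^2 >= 0], with [a] and [b] the norms of [x] and [y], gives the
    inequality multiplied by [2ab]. *)
Lemma euclidean_cauchy_schwarz x y :
  \sum_i x ord0 i * y ord0 i <= euclidean_norm x * euclidean_norm y.
Proof.
have [->|/euclidean_norm_gt0 a0] := eqVneq x 0.
  by rewrite euclidean_norm0 mul0r big1// => i _; rewrite mxE mul0r.
have [->|/euclidean_norm_gt0 b0] := eqVneq y 0.
  by rewrite euclidean_norm0 mulr0 big1// => i _; rewrite mxE mulr0.
set a := euclidean_norm x in a0 *; set b := euclidean_norm y in b0 *.
have ab0 : 0 < 2 * a * b by rewrite !mulr_gt0.
rewrite -(ler_pM2l ab0) mulr_sumr.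
have -> : 2 * a * b * (a * b) =
    \sum_i (b ^+ 2 * x ord0 i ^+ 2 + a ^+ 2 * y ord0 i ^+ 2).
  rewrite big_split/= -!mulr_sumr -!sqr_euclidean_norm -/a -/b; ring.
apply: ler_sum => i _; rewrite -subr_ge0.
have -> : b ^+ 2 * x ord0 i ^+ 2 + a ^+ 2 * y ord0 i ^+ 2
  - 2 * a * b * (x ord0 i * y ord0 i) = (b * x ord0 i - a * y ord0 i) ^+ 2.
  by ring.
exact: sqr_ge0.
Qed.

Lemma euclidean_normD x y :
  euclidean_norm (x + y) <= euclidean_norm x + euclidean_norm y.
Proof.
rewrite -(ler_pXn2r (n := 2)) ?nnegrE ?addr_ge0 ?euclidean_norm_ge0//.
rewrite sqrrD !sqr_euclidean_norm.
under eq_bigr do rewrite mxE sqrrD.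
rewrite !big_split/= lerD2r lerD2l -mulr2n (lerMn2r 2).
exact: euclidean_cauchy_schwarz.
Qed.

End EuclideanNorm.

(** * Integer combinations: weights and uniqueness of small coefficients *)

Section IntegerCombinations.
Context {R : realType} {n : nat} {v : nat -> 'rV[R]_n} {p : nat -> R}.
Hypothesis vp : is_SNP v p.
Implicit Types (c d : nat -> int) (m k : nat).

Local Notation weight := (int_comb_weight p).

Lemma int_combB m c d :
  int_comb v m (fun j => c j - d j) = int_comb v m c - int_comb v m d.
Proof. by rewrite /int_comb -sumrB; apply: eq_bigr => j _; rewrite mulrzBr. Qed.

Lemma int_combS m c : int_comb v m.+1 c = int_comb v m c + v m *~ c m.
Proof. by rewrite /int_comb big_ord_recr. Qed.

Lemma eq_int_comb {m c d} :
  (forall j, (j < m)%N -> c j = d j) -> int_comb v m c = int_comb v m d.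
Proof. by move=> cd; apply: eq_bigr => j _; rewrite cd. Qed.

Lemma weightS m c : weight m.+1 c = weight m c + `|c m|%:~R * p m.
Proof. by rewrite /int_comb_weight big_ord_recr. Qed.

Lemma eq_weight {m c d} :
  (forall j, (j < m)%N -> c j = d j) -> weight m c = weight m d.
Proof. by move=> cd; apply: eq_bigr => j _; rewrite cd. Qed.

Lemma weight0 m : weight m (fun=> 0) = 0.
Proof. by apply: big1 => j _; rewrite normr0 mul0r. Qed.

Lemma coord_weight_ge0 j (z : int) : 0 <= `|z|%:~R * p j.
Proof. by rewrite mulr_ge0 ?ler0z// ltW// (snp_p_gt0 vp). Qed.

Lemma weight_nondecreasing c : {homo (weight^~ c) : m k / (m <= k)%N >-> m <= k}.
Proof.
apply: homo_leq => [//|y x z|m]; first exact: le_trans.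
by rewrite weightS lerDl coord_weight_ge0.
Qed.

Lemma coord_le_weight j m c : (j < m)%N -> `|c j|%:~R * p j <= weight m c.
Proof.
move=> jm; rewrite (le_trans _ (weight_nondecreasing c _ _ jm))//.
by rewrite weightS lerDr (int_comb_weight_ge0 vp).
Qed.

Lemma weightB m c d : weight m (fun j => c j - d j) <= weight m c + weight m d.
Proof.
rewrite /int_comb_weight -big_split/=; apply: ler_sum => j _.
rewrite -mulrDl ler_wpM2r//; first exact/ltW/(snp_p_gt0 vp).
by rewrite -intrD ler_int ler_normB.
Qed.

(** Below [k] the differences vanish; from [k] on, the triangle inequality bounds them by the two
    tails. *)
Lemma weightB_agree k m c d : (k <= m)%N -> (forall j, (j < k)%N -> c j = d j) ->
  weight m (fun j => c j - d j) <=
  (weight m c - weight k c) + (weight m d - weight k d).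
Proof.
move=> + cd; elim: m => [|m IH].
  by rewrite leqn0 => /eqP ->; rewrite !subrr addr0 /int_comb_weight big_ord0.
rewrite leq_eqVlt => /predU1P[<-|]; last rewrite ltnS => /IH mk.
  rewrite !subrr addr0 [leLHS](@eq_weight _ _ (fun=> 0)) ?weight0//.
  by move=> j jk; rewrite cd ?subrr.
rewrite !weightS.
have : `|c m - d m|%:~R * p m <= `|c m|%:~R * p m + `|d m|%:~R * p m.
  rewrite -mulrDl ler_wpM2r//; first exact/ltW/(snp_p_gt0 vp).
  by rewrite -intrD ler_int ler_normB.
by move: mk; lra.
Qed.

Hypothesis growth : \forall j \near \oo, 1 <= p j *
  (Num.floor (euclidean_norm (v j.+1) / euclidean_norm (v j) - 1))%:~R.

(* Coefficients of small weight vanish below the threshold J of [growth]; above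
   it they are smaller than |v_{k+1}| / |v_k| - 1, so the norm of a partial
   combination telescopes to less than the norm of the next vector. *)
Lemma small_int_comb_eq0 : exists2 e : R, 0 < e & forall m c,
  weight m c < e -> int_comb v m c = 0 -> forall j, (j < m)%N -> c j = 0.
Proof.
have [J _ HJ] := growth.
(* A weight below [p J] leaves no room for a nonzero coefficient at an index up to [J]; a weight
   below 1 gives [|c_k| p_k < 1], to be compared with [growth] beyond [J]. *)
exists (Num.min 1 (p J)); first by rewrite lt_min ltr01 (snp_p_gt0 vp).
move=> m c; rewrite lt_min => /andP[W1 WJ].
have nv j : 0 < euclidean_norm (v j).
  by apply: euclidean_norm_gt0; exact: snp_v_neq0 vp j.
have small j : (j < m)%N -> (j <= J)%N -> c j = 0.
  move=> jm jJ; apply/eqP/negPn/negP; rewrite -normr_gt0 => c0.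
  have := le_lt_trans (coord_le_weight _ _ c jm) WJ; rewrite ltNge => /negP; apply.
  rewrite (le_trans (snp_p_nonincreasing vp jJ))// ler_peMl//.
    exact/ltW/(snp_p_gt0 vp).
  by rewrite ler1z.
have bound k : (k <= m)%N -> euclidean_norm (int_comb v k c) < euclidean_norm (v k).
  elim: k => [|k IH] km; first by rewrite /int_comb big_ord0 euclidean_norm0.
  rewrite int_combS; have [kJ|Jk] := leqP k J.
    rewrite small// mulr0z addr0 (lt_le_trans (IH (ltnW km)))//.
    exact: (snp_v_nondecreasing vp).
  rewrite (le_lt_trans (euclidean_normD _ _))// euclidean_normMz.
  rewrite (lt_le_trans (ltr_leD (IH (ltnW km)) (lexx _)))//.
  have /= := HJ k (ltnW Jk); set q := Num.floor _ => pq.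
  have ck : (`|c k|%:~R : R) <= q%:~R.
    rewrite -(ler_pM2r (snp_p_gt0 vp k)) (mulrC q%:~R).
    by rewrite (le_trans _ pq)// ltW// (le_lt_trans _ W1)// coord_le_weight.
  have := le_trans ck (floor_le _).
  by rewrite lerBrDr ler_pdivlMr// mulrDl mul1r addrC.
(* The top coefficient goes first: [|c_m| |v_m|] is the norm of the remaining combination, hence
   less than [|v_m|], so the integer [c_m] is 0. *)
elim: m => [//|m IH] in W1 WJ small bound *.
rewrite int_combS => /eqP; rewrite addr_eq0 => /eqP cm.
have cm0 : c m = 0.
  apply/eqP/negPn/negP; rewrite -normr_gt0 => c0.
  have := bound m (leqnSn m); rewrite cm -mulrNz euclidean_normMz normrN.
  by rewrite ltNge => /negP; apply; rewrite ler_peMl ?euclidean_norm_ge0// ler1z.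
move=> j; rewrite ltnS leq_eqVlt => /predU1P[->//|jm].
have le_m := weight_nondecreasing c _ _ (leqnSn m).
apply: IH => //.
- exact: le_lt_trans W1.
- exact: le_lt_trans WJ.
- by move=> i im; apply: small; exact: ltnW.
- by move=> k km; apply: bound; exact: leqW.
- by rewrite cm cm0 mulr0z oppr0.
Qed.

(** Two combinations of one vector with weights below [e / 2] differ by a combination equal to 0 of
    weight below [e], so their coefficients agree; hence no expansion is cheaper than a small
    one. *)
Lemma sigma_small_int_comb : exists2 e : R, 0 < e &
  forall m c, weight m c < e -> sigma v p (int_comb v m c) = weight m c.
Proof.
have [e e0 He] := small_int_comb_eq0.
exists (e / 2); first by rewrite divr_gt0.
move=> m c Wc; apply/eqP; rewrite eq_le sigma_le//=.
apply: lb_le_inf; first by exists (weight m c), m, c.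
move=> _ [k [d [cd ->]]]; rewrite leNgt; apply/negP => dc.
rewrite (int_comb_widen _ c (leq_maxl m k)) in cd.
rewrite (int_comb_widen _ d (leq_maxr m k)) in cd.
rewrite (int_comb_weight_widen _ c (leq_maxl m k)) in Wc dc.
rewrite (int_comb_weight_widen _ d (leq_maxr m k)) in dc.
set c' := (fun j => _) in cd Wc dc; set d' := (fun j => _) in cd dc.
suff : weight (maxn m k) d' = weight (maxn m k) c' by move: dc => /[swap] ->; rewrite ltxx.
apply: eq_weight => j jM; apply/esym/eqP; rewrite -subr_eq0; apply/eqP.
move: j jM; apply: (He (maxn m k) (fun j => c' j - d' j)).
  by rewrite (le_lt_trans (weightB _ _ _))// [e]splitr ltrD// (lt_trans dc).
by rewrite int_combB cd subrr.
Qed.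

End IntegerCombinations.

(** * Coordinates of the points of the completion near 0 *)

Lemma mdist_lipschitz {R : realType} {X : metricType R} (x y x' y' : X) :
  `|mdist x y - mdist x' y'| <= mdist x x' + mdist y y'.
Proof.
have := metric_triangle x x' y; have := metric_triangle x' y' y.
have := metric_triangle x' x y'; have := metric_triangle x y y'.
by rewrite (metric_sym x' x) (metric_sym y' y) ler_norml; lra.
Qed.

Section LocalCoordinates.
Context {R : realType} {n : nat} {v : nat -> 'rV[R]_n} {p : nat -> R}.
Hypothesis vp : is_SNP v p.
Implicit Types (c d : nat -> int) (m k : nat).

Local Notation weight := (int_comb_weight p).
Local Notation X := (completion (sigma_seminorm vp)).
Implicit Types x y : X.

Lemma int_comb_generated m c : int_comb v m c \in generated_pred v.
Proof. by apply/asboolP; exists m, c. Qed.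

Definition generated_comb m c : generated_group v :=
  GeneratedGroup (int_comb_generated m c).

Definition comb_embed m c : X :=
  completion_embed (sigma_seminorm vp) (generated_comb m c).

Lemma comb_embed_widen m k c : (m <= k)%N ->
  comb_embed m c = comb_embed k (fun j => if (j < m)%N then c j else 0).
Proof.
move=> mk; congr completion_embed; apply: val_inj => /=.
exact: int_comb_widen.
Qed.

Lemma eq_comb_embed {m c d} :
  (forall j, (j < m)%N -> c j = d j) -> comb_embed m c = comb_embed m d.
Proof.
by move=> cd; congr completion_embed; apply: val_inj; exact: eq_int_comb.
Qed.

Lemma mdist0E x : mdist x 0 = completion_norm x.
Proof. by rewrite {1}/mdist/= /completion_dist subr0. Qed.

Lemma comb_embed0 m : comb_embed m (fun=> 0) = 0.
Proof.
have E : generated_comb m (fun=> 0) = 0 - 0.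
  by rewrite subrr; apply: val_inj; apply: big1 => j _; rewrite mulr0z.
by rewrite /comb_embed E completion_embedB subrr.
Qed.

Context {eps : R}.
Hypothesis eps_gt0 : 0 < eps.
Hypothesis sigma_weight : forall m c,
  weight m c < eps -> sigma v p (int_comb v m c) = weight m c.

Lemma mdist_comb_embed m c d : weight m (fun j => c j - d j) < eps ->
  mdist (comb_embed m c) (comb_embed m d) = weight m (fun j => c j - d j).
Proof.
move=> W; rewrite completion_embed_isometry /= -sigma_weight//.
by rewrite int_combB.
Qed.

Lemma comb_embed_norm m c : weight m c < eps ->
  completion_norm (comb_embed m c) = weight m c.
Proof.
have E : weight m (fun j => c j - 0) = weight m c.
  by apply: eq_weight => j _; rewrite subr0.
rewrite -mdist0E -(comb_embed0 m) -E; exact: mdist_comb_embed.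
Qed.

(** Padded with zeros, the shorter combination has no tail after [m], so [weightB_agree] leaves only
    the tail of [c]. *)
Lemma mdist_comb_embed_tail m k c : (m <= k)%N -> weight k c - weight m c < eps ->
  mdist (comb_embed m c) (comb_embed k c) <= weight k c - weight m c.
Proof.
move=> mk W; rewrite (comb_embed_widen _ _ c mk).
set c' := (fun j => _).
have := weightB_agree vp _ _ c' c mk.
rewrite -(int_comb_weight_widen _ c mk) (@eq_weight _ _ m c' c); last first.
  by move=> j jm; rewrite /c' jm.
rewrite subrr add0r => Wc; rewrite mdist_comb_embed; last first.
  by rewrite (le_lt_trans (Wc _) W)// => j jm; rewrite /c' jm.
by apply: Wc => j jm; rewrite /c' jm.
Qed.

(* [c] is the (possibly infinite) coordinate sequence of the point [x] close
   to 0, i.e. x = \sum_j c_j v_j in the completion. *)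
Definition represents x c : Prop :=
  (forall m, weight m c <= eps / 4) /\ comb_embed m c @[m --> \oo] --> x.

Lemma represents0 : represents 0 (fun=> 0).
Proof.
split=> [m|]; first by rewrite weight0 divr_ge0// ltW.
under eq_cvg do rewrite comb_embed0; exact: cvg_cst.
Qed.

Lemma represents_mdist {x y c d} : represents x c -> represents y d ->
  weight m (fun j => c j - d j) @[m --> \oo] --> mdist x y.
Proof.
move=> [Wc cx] [Wd dy]; apply/cvgrPdist_lt => e e0.
have e20 : 0 < e / 2 by rewrite divr_gt0.
have [K _ cK] := metricType_numDomainType.cvgr_dist_lt cx e20.
have [L _ dL] := metricType_numDomainType.cvgr_dist_lt dy e20.
exists (maxn K L) => // m; rewrite /= geq_max => /andP[/cK/= cm /dL/= dm].
(* Weights of at most [eps / 4] each make the difference weigh less than [eps], where distance and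
   weight agree. *)
rewrite -mdist_comb_embed; last first.
  rewrite (le_lt_trans (weightB vp _ _ _))//.
  by have := Wc m; have := Wd m; move: eps_gt0; lra.
rewrite (le_lt_trans (mdist_lipschitz _ _ _ _))// [e]splitr.
exact: ltrD.
Qed.

Lemma represents_norm {x c} :
  represents x c -> weight m c @[m --> \oo] --> completion_norm x.
Proof.
move=> xc; have := represents_mdist xc represents0; rewrite mdist0E.
apply: cvg_trans; apply: near_eq_cvg; apply: nearW => m.
by apply: eq_weight => j _; rewrite subr0.
Qed.

Lemma coord_le_mdist {x y c d} j : represents x c -> represents y d ->
  `|c j - d j|%:~R * p j <= mdist x y.
Proof.
move=> xc yd; have := represents_mdist xc yd => W.
rewrite -(cvg_lim _ W)//; apply: limr_ge; first exact: cvgP W.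
by exists j.+1 => // m jm; exact: (coord_le_weight vp j m (fun j => c j - d j)).
Qed.

(** Distinct integers differ by at least 1, so a disagreement at [j] costs at least [p j]: this
    makes coordinates locally constant. *)
Lemma coord_eq {x y c d} j : represents x c -> represents y d ->
  mdist x y < p j -> c j = d j.
Proof.
move=> xc yd xy; apply/eqP; rewrite -subr_eq0 -normr_le0 leNgt; apply/negP => cd.
have := le_lt_trans (coord_le_mdist j xc yd) xy; rewrite ltNge => /negP; apply.
by rewrite ler_peMl ?ler1z// ltW// (snp_p_gt0 vp).
Qed.

Lemma mdist_agree k {x y c d} : represents x c -> represents y d ->
  (forall j, (j < k)%N -> c j = d j) ->
  mdist x y <= (completion_norm x - weight k c) + (completion_norm y - weight k d).
Proof.
move=> xc yd cd; apply: (ler_cvg_to (represents_mdist xc yd)).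
  apply: cvgD; (apply: cvgB; last exact: cvg_cst).
    exact: represents_norm xc.
  exact: represents_norm yd.
by exists k => // m km; exact: (weightB_agree vp).
Qed.

Lemma represents_inj {x y c} : represents x c -> represents y c -> x = y.
Proof.
move=> [_ cx] [_ cy].
exact: (cvg_unique (@metric_hausdorff R X) cx cy).
Qed.

(** The late terms of a Cauchy sequence tending to [x] have small expansions whose differences weigh
    no more than the distances of the terms. So each coordinate is eventually constant, and the
    eventual values are the coordinates of [x]. *)
Lemma small_norm_represents x :
  completion_norm x < eps / 8 -> exists c, represents x c.
Proof.
have [u ->] := completion_classP x; rewrite completion_normE => u8.
have [K0 HK0] : exists K0, forall k, (K0 <= k)%N ->
    sigma_seminorm vp (cseq u k) < eps / 8.
  have [K0 _ HK0] := cvgr_lt _ (@cseq_norm_cvg _ _ _ u) _ u8.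
  by exists K0.
(* Padding with zeros makes an expansion valid at every length [m >= mc.1], so that two of them can
   be compared at a common length. *)
pose expands k (mc : nat * (nat -> int)) := forall m, (mc.1 <= m)%N ->
  val (cseq u k) = int_comb v m mc.2 /\ weight m mc.2 < eps / 4.
have /choice[mc Hmc] k : exists mc, (K0 <= k)%N -> expands k mc.
  have [Kk|_] := leqP K0 k; last by exists (0%N, fun=> 0).
  have e80 : 0 < eps / 8 by rewrite divr_gt0.
  have [m [c [uE Wc]]] := sigma_approx vp (cseq u k) e80.
  exists (m, fun j => if (j < m)%N then c j else 0) => _ M /= mM.
  rewrite -(int_comb_widen _ _ mM) -(int_comb_weight_widen _ _ mM); split => //.
  by rewrite (lt_trans Wc)//; have := HK0 _ Kk; rewrite /=; lra.
pose cc k := (mc k).2; pose mm k := (mc k).1.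
have W k M : (K0 <= k)%N -> weight M (cc k) < eps / 4.
  move=> Kk; have [_ ] := Hmc _ Kk _ (leq_maxl (mm k) M).
  exact: le_lt_trans (weight_nondecreasing vp _ _ _ (leq_maxr _ _)).
have D k l M : (K0 <= k)%N -> (K0 <= l)%N ->
    weight M (fun j => cc k j - cc l j) <=
    sigma_seminorm vp (cseq u k - cseq u l).
  move=> Kk Kl; pose M' := maxn M (maxn (mm k) (mm l)).
  have [uk _] := Hmc _ Kk M' ltac:(by rewrite !leq_max leqnn orbT).
  have [ul _] := Hmc _ Kl M' ltac:(by rewrite !leq_max leqnn !orbT).
  have -> : sigma_seminorm vp (cseq u k - cseq u l) =
      sigma v p (val (cseq u k) - val (cseq u l)) by [].
  rewrite uk ul -int_combB sigma_weight.
    exact: (weight_nondecreasing vp _ _ _ (leq_maxl _ _)).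
  rewrite (le_lt_trans (weightB vp _ _ _))//.
  by have := W k M' Kk; have := W l M' Kl; rewrite /cc; move: eps_gt0; lra.
have uC e : 0 < e -> exists2 K, (K0 <= K)%N & forall k l, (K <= k)%N ->
    (K <= l)%N -> sigma_seminorm vp (cseq u k - cseq u l) < e.
  move=> e0; have /asboolP/(_ _ e0)[K HK] := cseq_cauchy u.
  exists (maxn K0 K); first exact: leq_maxl.
  by move=> k l; rewrite !geq_max => /andP[_ Kk] /andP[_ Kl]; exact: HK.
have /choice[s Hs] j : exists s,
    (K0 <= s)%N /\ forall k, (s <= k)%N -> cc k j = cc s j.
  have [s Ks Hs] := uC _ (snp_p_gt0 vp j); exists s; split=> // k sk.
  apply/eqP; rewrite -subr_eq0 -normr_le0 leNgt; apply/negP => ccj.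
  have := le_lt_trans (D k s j.+1 (leq_trans Ks sk) Ks) (Hs _ _ sk (leqnn _)).
  rewrite ltNge => /negP; apply; rewrite weightS.
  rewrite (le_trans _ (_ : `|cc k j - cc s j|%:~R * p j <= _))//.
    by rewrite ler_peMl ?ler1z// ltW// (snp_p_gt0 vp).
  by rewrite lerDr (int_comb_weight_ge0 vp).
pose c j := cc (s j) j.
(* Finitely many coordinates have all settled at the largest of their stages, so a single late term
   [l] shows them all. *)
have stable K M : exists l, (K <= l)%N /\ forall j, (j < M)%N -> c j = cc l j.
  exists (maxn K (\max_(j < M) s j)); split; first exact: leq_maxl.
  move=> j jM; have [_ ->//] := Hs j; rewrite leq_max; apply/orP; right.
  exact: (leq_bigmax (F := fun i : 'I_M => s i) (Ordinal jM)).
exists c; split.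
  move=> m; have [l [Kl /eq_weight ->]] := stable K0 m; exact/ltW/W.
apply/(@metricType_numDomainType.cvgrPdist_lt R) => e e0.
have e20 : 0 < e / 2 by rewrite divr_gt0.
have [K KK0 HK] := uC _ e20.
have [L HL] := completion_embed_approx u e20.
pose k := maxn K L; have Kk : (K <= k)%N by exact: leq_maxl.
have K0k := leq_trans KK0 Kk.
exists (mm k) => // m /= mk.
rewrite (le_lt_trans (metric_triangle _ (completion_embed _ (cseq u k)) _))//.
rewrite [e]splitr ler_ltD//; first by rewrite metric_sym HL// leq_maxr.
(* Below [m], [c] is replaced by a late term [l], and the Cauchy bound between [k] and [l] controls
   the distance. *)
have [l [Kl cl]] := stable K m.
have -> : completion_embed (sigma_seminorm vp) (cseq u k) = comb_embed m (cc k).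
  by congr completion_embed; apply: val_inj; have [] := Hmc _ K0k _ mk.
rewrite (eq_comb_embed cl).
have Dkl := le_lt_trans (D k l m K0k (leq_trans KK0 Kl)) (HK _ _ Kk Kl).
rewrite mdist_comb_embed//.
rewrite (le_lt_trans (weightB vp _ _ _))//.
have := W k m K0k; have := W l m (leq_trans KK0 Kl).
by move: eps_gt0; lra.
Qed.

End LocalCoordinates.

(** * Local total disconnectedness and dimension at most one *)

Lemma open_subset_type {R : realType} {X : metricType R} (A : set X)
    (U : set (set_type A)) :
  (forall a, U a -> exists2 e, 0 < e &
    forall b, mdist (set_val a) (set_val b) < e -> U b) -> open U.
Proof.
move=> HU; exists (\bigcup_(ae in [set ae : set_type A * R | U ae.1 /\ 0 < ae.2 /\
    forall b, mdist (set_val ae.1) (set_val b) < ae.2 -> U b])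
    interior (ball (set_val ae.1) ae.2)).
  by apply: bigcup_open => ae _; exact: open_interior.
apply/seteqP; split=> [b [[a e] /= [_ [_ ]]]|a Ua].
  by move=> + /interior_subset; rewrite ballEmdist; exact.
have [e e0 He] := HU _ Ua; exists (a, e) => //=.
exact: nbhsx_ballx.
Qed.

(** As [ind_lt 0] means emptiness, this lemma and the next turn [ind_lt 1] into a statement on
    clopen neighbourhoods. *)
Lemma clopen_frontier_empty (T : topologicalType) (U : set T) :
  clopen U -> [set: set_type (closure U `\` U)] = set0.
Proof.
move=> [_ cU]; rewrite -subset0 => -[y yU] _.
have cUU : closure U `<=` U by rewrite -(iffLR (closure_id U) cU).
by have [/cUU] := set_mem yU.
Qed.

Lemma frontier_empty_closed (T : topologicalType) (U : set T) :
  [set: set_type (closure U `\` U)] = set0 -> closed U.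
Proof.
move=> U0 y cy; apply: contrapT => nUy.
have yD : y \in closure U `\` U by apply/mem_set.
by have : [set: set_type (closure U `\` U)] (exist _ y yD) by []; rewrite U0.
Qed.

Section LocalTopology.
Context {R : realType} {n : nat} {v : nat -> 'rV[R]_n} {p : nat -> R}.
Hypothesis vp : is_SNP v p.
Implicit Types (c d : nat -> int) (m k : nat).

Local Notation weight := (int_comb_weight p).
Local Notation X := (completion (sigma_seminorm vp)).
Local Notation comb_embed := (comb_embed vp).
Implicit Types x y : X.

Context {eps : R}.
Hypothesis eps_gt0 : 0 < eps.
Hypothesis sigma_weight : forall m c,
  weight m c < eps -> sigma v p (int_comb v m c) = weight m c.
Local Notation represents := (represents vp (eps := eps)).

Lemma coordinates : exists C : X -> nat -> int,
  forall x, completion_norm x < eps / 8 -> represents x (C x).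
Proof.
have /choice[C HC] x :
    exists c, completion_norm x < eps / 8 -> represents x c.
  have [x8|_] := ltP (completion_norm x) (eps / 8); last by exists (fun=> 0).
  by have [c xc] := small_norm_represents vp eps_gt0 sigma_weight x x8; exists c.
by exists C.
Qed.

Lemma p_lt e : 0 < e -> exists J, forall j, (J <= j)%N -> p j < e.
Proof.
by move=> e0; have [J _ HJ] := cvgr_lt _ (snp_p_cvg0 vp) _ e0; exists J.
Qed.

Lemma completion_locally_totally_disconnected : locally_totally_disconnected X.
Proof.
have e8 : 0 < eps / 8 by rewrite divr_gt0.
have [C HC] := coordinates.
exists (ball (0 : X) (eps / 8)); first exact: nbhsx_ballx.
have inB x : ball (0 : X) (eps / 8) x -> represents x (C x).
  by rewrite ballEmdist /= metric_sym mdist0E; exact: HC.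
move=> x Bx; apply/seteqP; split=> [y [Y [Yx YB cY] Yy]|_ ->]; last first.
  exact: connected_component_refl.
have same j : C x j = C y j.
  (* [O P] is open in [X] and cuts out of [Y] the points whose coordinate [j] satisfies [P], since
     points of [Y] closer than [p j] share that coordinate. *)
  pose O (P : int -> Prop) : set X :=
    \bigcup_(z in [set z | Y z /\ P (C z j)]) interior (ball z (p j)).
  have oO P : open (O P) by apply: bigcup_open => z _; exact: open_interior.
  have OE P z : Y z -> O P z <-> P (C z j).
    move=> Yz; split=> [[w [Yw Pw] /interior_subset]|Pz].
      rewrite ballEmdist /= => wz.
      by rewrite -(coord_eq vp eps_gt0 sigma_weight j (inB _ (YB _ Yw))
        (inB _ (YB _ Yz)) wz).
    by exists z => //; apply: nbhsx_ballx; exact: snp_p_gt0 vp j.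
  suff : Y `&` [set z | C x j = C z j] = Y by move/seteqP => [_ /(_ _ Yy)[]].
  (* One value of the coordinate gives a trace that is open by [O], and closed as the complement of
     the other values. *)
  apply: cY; first by exists x.
  - exists (O (eq (C x j))) => //.
    by apply/seteqP; split=> z [Yz /(OE _ _ Yz)].
  - exists (~` O (fun t => C x j <> t)); first exact: open_closedC.
    apply/seteqP; split=> z [Yz Ez]; split=> //; first by move/(OE _ _ Yz).
    by apply: contrapT => xz; apply: Ez; apply/(OE _ _ Yz).
apply: (represents_inj vp _ (inB _ Bx)).
have -> : C x = C y by apply/funext.
exact/inB/YB.
Qed.

Lemma mdist_translate z x y : mdist (x - z) (y - z) = mdist x y.
Proof. by rewrite /mdist/= /completion_dist opprB addrA subrK. Qed.

(* On a sphere the coordinates determine the topology: if two sequences of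
   equal total weight agree up to index K, then so do their tail weights. *)
Lemma sphere_zero_dimensional x (r : R) (A : set X) : r < eps / 8 ->
  (forall y, A y -> mdist y x = r) -> ind_lt 1 (set_type A).
Proof.
move=> r8 Ar; have [C HC] := coordinates.
have AC (b : set_type A) : represents (set_val b - x) (C (set_val b - x)).
  by apply: HC; rewrite -[X in X < _]/(mdist (set_val b) x) Ar//; apply: set_valP.
move=> a V [W oW <-] Wa.
have /(@metricType_numDomainType.nbhs_mdistP R)[d /= d0 dW] :
  nbhs (set_val a) W by exact: open_nbhs_nbhs.
have d20 : 0 < d / 2 by rewrite divr_gt0.
have := represents_norm vp eps_gt0 sigma_weight (AC a).
(* [K] cuts the sequence of [a] where its tail weighs less than [d / 2]. On the sphere, every point
   of the cylinder [U] over the first [K] coordinates has the same tail weight, so it lies within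
   [d] of [a]. *)
move=> /cvgrPdist_lt/(_ _ d20)[K _ /(_ _ (leqnn _))/=].
rewrite -[completion_norm _]/(mdist (set_val a) x) Ar; last exact: set_valP.
move=> HK; pose c (b : set_type A) := C (set_val b - x).
pose U := [set b : set_type A | forall j, (j < K)%N -> c b j = c a j].
have U_loc b b' : mdist (set_val b) (set_val b') < p K ->
    forall j, (j < K)%N -> c b j = c b' j.
  move=> bb' j jK; apply: (coord_eq vp eps_gt0 sigma_weight _ (AC b) (AC b')).
  rewrite mdist_translate (lt_le_trans bb')//.
  exact: (snp_p_nonincreasing vp (ltnW jK)).
have oU : open U.
  apply: open_subset_type => b Ub; exists (p K); first exact: snp_p_gt0 vp K.
  by move=> b' bb' j jK; rewrite -(U_loc _ _ bb')// Ub.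
have cU : closed U.
  rewrite -[U]setCK; apply/open_closedC/open_subset_type => b Ub.
  exists (p K); first exact: snp_p_gt0 vp K.
  by move=> b' bb' Ub'; apply: Ub => j jK; rewrite (U_loc _ _ bb')// Ub'.
exists U; split => //; last exact: clopen_frontier_empty.
move=> b Ub; apply: dW => /=.
rewrite -(mdist_translate x).
rewrite (le_lt_trans (mdist_agree vp eps_gt0 sigma_weight K (AC a) (AC b) _))//.
  by move=> j jK; rewrite -/(c a j) -Ub.
rewrite -![completion_norm (_ - _)]/(mdist _ x) !Ar; try exact: set_valP.
rewrite [X in _ + (_ - X)](@eq_weight _ _ _ _ (c a)); last first.
  by move=> j jK; exact: Ub.
by move: HK; rewrite ltr_norml => /andP[_]; rewrite /c; lra.
Qed.

Lemma completion_ind_lt2 : ind_lt 2 X.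
Proof.
move=> x V oV Vx.
have /(@metricType_numDomainType.nbhs_mdistP R)[d /= d0 dV] :
  nbhs x V by exact: open_nbhs_nbhs.
(* [eps / 9] keeps the radius strictly below [eps / 8], as the lemma on spheres demands. *)
pose r := Num.min d (eps / 9).
have r0 : 0 < r by rewrite lt_min d0/= divr_gt0.
exists [set y | mdist y x < r]; split.
- rewrite openE => y /= yx; apply/(@metricType_numDomainType.nbhs_mdistP R).
  exists (r - mdist y x); first by rewrite /= subr_gt0.
  move=> z /=; rewrite ltrBrDr metric_sym; apply: le_lt_trans.
  exact: metric_triangle.
- by rewrite /= mdistxx.
- by move=> y /= yx; apply: dV => /=; rewrite metric_sym (lt_le_trans yx)// ge_min lexx.
- apply: (@sphere_zero_dimensional x r).
    by rewrite gt_min; apply/orP; right; move: eps_gt0; lra.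
  move=> y [cy /negP]; rewrite -leNgt => ry; apply/eqP; rewrite eq_le ry andbT.
  apply/ler_addgt0Pr => e e0; have [z []] := cy _ (nbhsx_ballx y e e0).
  rewrite ballEmdist /= => zx yz.
  by rewrite (le_trans (metric_triangle _ z _))// addrC lerD// ltW.
Qed.

End LocalTopology.

(** * Absence of small clopen and of compact neighbourhoods of 0 *)

Definition update {T : Type} (c : nat -> T) (m : nat) (z : T) : nat -> T :=
  fun j => if j == m then z else c j.

Lemma update_lt {T : Type} (c : nat -> T) m z j :
  (j < m)%N -> update c m z j = c j.
Proof. by rewrite /update => /ltn_eqF ->. Qed.

Lemma update_eq {T : Type} (c : nat -> T) m z : update c m z m = z.
Proof. by rewrite /update eqxx. Qed.

Section GlobalTopology.
Context {R : realType} {n : nat} {v : nat -> 'rV[R]_n} {p : nat -> R}.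
Hypothesis vp : is_SNP v p.
Implicit Types (c d : nat -> int) (m k : nat).

Local Notation weight := (int_comb_weight p).
Local Notation X := (completion (sigma_seminorm vp)).
Local Notation comb_embed := (comb_embed vp).
Implicit Types x y : X.

Context {eps : R}.
Hypothesis eps_gt0 : 0 < eps.
Hypothesis sigma_weight : forall m c,
  weight m c < eps -> sigma v p (int_comb v m c) = weight m c.

Lemma weight_update c m z :
  weight m.+1 (update c m z) = weight m c + `|z|%:~R * p m.
Proof.
rewrite weightS update_eq; congr (_ + _).
by apply: eq_weight => j; exact: update_lt.
Qed.

Lemma comb_embed_update0 c m : comb_embed m.+1 (update c m 0) = comb_embed m c.
Proof.
rewrite (comb_embed_widen vp m m.+1 c (leqnSn m)).
apply: eq_comb_embed => j; rewrite ltnS leq_eqVlt => /predU1P[->|jm].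
  by rewrite update_eq ltnn.
by rewrite update_lt// jm.
Qed.

Lemma natr_ge_multiple (a q : R) : 0 <= a -> 0 < q ->
  exists k : nat, a < k%:R * q <= a + q.
Proof.
move=> a0 q0; exists (Num.truncn (a / q)).+1.
have aq0 : 0 <= a / q by rewrite divr_ge0// ltW.
have /andP[lo hi] := truncn_itv aq0.
move: hi; rewrite ltr_pdivrMr// => -> /=.
by rewrite -natr1 mulrDl mul1r lerD2r -ler_pdivlMr.
Qed.

(** Raising coordinate [m] from 0 by units makes the norm pass [eps / 8], so the point must leave
    [U]; [z] is the last value before the first exit. *)
Lemma exit_step (U : set X) : (forall x, U x -> completion_norm x < eps / 8) ->
  forall c m, p m < eps / 8 -> U (comb_embed m c) -> weight m c < eps / 8 ->
  exists z : int, [/\ U (comb_embed m.+1 (update c m z)),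
    weight m.+1 (update c m z) < eps / 8 &
    ~ U (comb_embed m.+1 (update c m (z + 1)))].
Proof.
move=> Ub c m pm Uc Wc.
have e8 : 0 < eps / 8 by rewrite divr_gt0.
have p0 := snp_p_gt0 vp m.
have W0 := int_comb_weight_ge0 vp m c.
pose w (k : nat) := weight m.+1 (update c m k%:Z).
have wE k : w k = weight m c + k%:R * p m by rewrite /w weight_update.
have [k0 /andP[k0l k0u]] := natr_ge_multiple _ _ (ltW e8) p0.
have wk0 k : (k <= k0)%N -> w k < eps.
  move=> kk; rewrite wE; have : k%:R * p m <= k0%:R * p m.
    by rewrite ler_pM2r// ler_nat.
  by move: k0u pm Wc; lra.
have normw k : (k <= k0)%N ->
    completion_norm (comb_embed m.+1 (update c m k%:Z)) = w k.
  by move=> kk; rewrite (comb_embed_norm vp sigma_weight)//; exact: wk0.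
pose out (k : nat) := `[< ~ U (comb_embed m.+1 (update c m k%:Z)) >].
have out0 : out k0.
  apply/asboolP => /Ub; rewrite normw// wE; move: k0l W0; lra.
have exout : exists k, out k by exists k0.
(* The first exit is not at 0: a zero coefficient does not move the point. *)
case: (ex_minnP exout) => -[|k] /asboolP outk kmin.
  by exfalso; apply: outk; rewrite comb_embed_update0.
have Uk : U (comb_embed m.+1 (update c m k%:Z)).
  apply: contrapT => nU; have : (k.+1 <= k)%N by apply: kmin; exact/asboolP.
  by rewrite ltnn.
exists k%:Z; split => //.
  by rewrite -/(w k) -normw ?Ub// ltnW// kmin.
by rewrite addrC -intS.
Qed.

Lemma not_completion_ind_lt1 : ~ ind_lt 1 X.
Proof.
have e8 : 0 < eps / 8 by rewrite divr_gt0.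
move=> /(_ 0 (interior (ball (0 : X) (eps / 8)))).
move=> /(_ (@open_interior _ _) (nbhsx_ballx _ _ e8)).
move=> [U [oU U0 UV /frontier_empty_closed cU]].
have Ub x : U x -> completion_norm x < eps / 8.
  by move=> /UV/interior_subset; rewrite ballEmdist /= metric_sym mdist0E.
have [J HJ] := p_lt vp _ e8.
pose good c m z := [/\ U (comb_embed m.+1 (update c m z)),
    weight m.+1 (update c m z) < eps / 8 &
    ~ U (comb_embed m.+1 (update c m (z + 1)))].
have /choice[f Hf] (cm : (nat -> int) * nat) : exists z, (J <= cm.2)%N ->
    U (comb_embed cm.2 cm.1) -> weight cm.2 cm.1 < eps / 8 -> good cm.1 cm.2 z.
  case: (pselect [/\ (J <= cm.2)%N, U (comb_embed cm.2 cm.1) &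
    weight cm.2 cm.1 < eps / 8]) => [[Jm Um Wm]|H].
    by have [z Hz] := exit_step U Ub _ _ (HJ _ Jm) Um Wm; exists z.
  by exists 0 => Jm Um Wm; exfalso; apply: H.
(* Stage [m] sets only coordinate [m], so the stages fit into one sequence [c]; the first [J]
   coordinates stay 0 because [exit_step] needs [p m < eps / 8]. *)
pose F := fix F m : nat -> int := if m is m'.+1 then
  update (F m') m' (if (m' < J)%N then 0 else f (F m', m')) else fun=> 0.
pose c j := F j.+1 j.
have FS m : F m.+1 = update (F m) m (if (m < J)%N then 0 else f (F m, m)) by [].
have Fc m j : (j < m)%N -> F m j = c j.
  elim: m => // m IH; rewrite ltnS leq_eqVlt => /predU1P[->//|jm].
  by rewrite FS update_lt// IH.
have inv m : U (comb_embed m (F m)) /\ weight m (F m) < eps / 8.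
  elim: m => [|m [Um Wm]]; first by rewrite comb_embed0 weight0.
  rewrite FS; case: ltnP => [_|Jm]; last by have [] := Hf (F m, m) Jm Um Wm.
  by rewrite comb_embed_update0 weight_update normr0 mul0r addr0.
have Uc m : U (comb_embed m c).
  by rewrite -(eq_comb_embed vp (Fc m)); have [] := inv m.
have Wc m : weight m c < eps / 8.
  by rewrite -(eq_weight (Fc m)); have [] := inv m.
have exit m : (J <= m)%N -> exists2 y : X, ~ U y & mdist (comb_embed m.+1 c) y <= p m.
  move=> Jm; have [Um Wm] := inv m.
  have [_ _ nU] := Hf (F m, m) Jm Um Wm.
  eexists; first exact: nU.
  rewrite -(eq_comb_embed vp (Fc m.+1)) FS ltnNge Jm /=.
  have W : weight m.+1 (fun j => update (F m) m (f (F m, m)) j -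
      update (F m) m (f (F m, m) + 1) j) = p m.
    rewrite weightS !update_eq opprD addNKr normrN normr1 mul1r.
    rewrite (@eq_weight _ _ _ _ (fun=> 0)) ?weight0 ?add0r//.
    by move=> j jm; rewrite !update_lt// subrr.
  by rewrite (mdist_comb_embed vp sigma_weight) W// (lt_trans (HJ _ Jm))//; move: eps_gt0; lra.
(* The nondecreasing weights are bounded, so the tails tend to 0 and the partial combinations form a
   Cauchy sequence. *)
have cvgW : cvgn (fun m => weight m c).
  apply: nondecreasing_is_cvgn; first by move=> i j; exact: (weight_nondecreasing vp c).
  by exists (eps / 8) => _ [m _ <-]; exact/ltW.
have cvgU : cvg (comb_embed m c @[m --> \oo]).
  apply/cauchy_cvgP/cauchy_exP => e e0.
  have [K _ HK] := cvgr_gt _ cvgW (lim (weight m c @[m --> \oo]) - e)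
    ltac:(by rewrite ltrBlDr ltrDl).
  exists (comb_embed K c), K => // m /= Km; rewrite ballEmdist /=.
  have WK := HK K (leqnn K).
  have Wm : weight m c <= lim (weight m c @[m --> \oo]).
    by apply: nondecreasing_cvgn_le => // i j; exact: (weight_nondecreasing vp c).
  rewrite (le_lt_trans (mdist_comb_embed_tail vp sigma_weight _ _ c Km _))//.
    have := int_comb_weight_ge0 vp K c; have := Wc m; move: eps_gt0; lra.
  by move: WK Wm => /=; lra.
have [x cx] := iffLR (cvg_ex _) cvgU.
(* The limit lies in the closed set [U], hence in its interior as [U] is open; yet points outside
   [U], within [p m] of the partial combinations, come arbitrarily close to it. *)
have Ux : U x by apply: (closed_cvg U cU _ _ cx); exact: nearW.
have /(@metricType_numDomainType.nbhs_mdistP R)[r /= r0 rU] : nbhs x U.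
  exact: open_nbhs_nbhs.
have r20 : 0 < r / 2 by rewrite divr_gt0.
have [K _ HK] := metricType_numDomainType.cvgr_dist_lt cx r20.
have [L HL] := p_lt vp _ r20.
pose m := maxn J (maxn K L).
have [y nUy] := exit m (leq_maxl _ _).
move=> my; apply: nUy; apply: rU => /=.
rewrite (le_lt_trans (metric_triangle _ (comb_embed m.+1 c) _))// [r]splitr ltrD//.
  by apply: HK; rewrite /= /m leqW// !leq_max leqnn orbT.
by rewrite (le_lt_trans my)// HL// /m !leq_max leqnn !orbT.
Qed.

Lemma completion_not_locally_compact : ~ locally_compact [set: X].
Proof.
move=> /(_ 0 I)[K]; rewrite /within/= => K0 [cK _].
have /(@metricType_numDomainType.nbhs_mdistP R)[d0 /= d00 dK] : nbhs (0 : X) K.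
  by apply: filterS K0 => y; exact.
(* Points of norm below [d] lie in [K], and the difference of two coefficient sequences of weight
   below [d] weighs less than [eps]. *)
pose d := Num.min d0 eps / 2.
have d_gt0 : 0 < d by rewrite divr_gt0// lt_min d00.
have d_d0 : d + d <= d0 by rewrite -splitr ge_min lexx.
have d_eps : d + d <= eps by rewrite -splitr ge_min lexx orbT.
have d20 : 0 < d / 2 by rewrite divr_gt0.
have [J HJ] := p_lt vp _ d20.
have /choice[z Hz] j : exists k : nat, d / 2 < k%:R * p j <= d / 2 + p j.
  by apply: natr_ge_multiple; [exact: ltW|exact: snp_p_gt0 vp j].
pose s j : nat -> int := update (fun=> 0) j (z j)%:Z.
have sW j : (J <= j)%N -> d / 2 < weight j.+1 (s j) < d.
  move=> Jj; rewrite weight_update weight0 add0r.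
  have /andP[-> /= zu] := Hz j; rewrite (le_lt_trans zu)//.
  by have := HJ _ Jj; lra.
have sWM j m : (j < m)%N -> weight m (s j) = weight j.+1 (s j).
  move=> jm; rewrite (int_comb_weight_widen _ (s j) jm).
  apply: eq_weight => i im; rewrite ltnS; case: leqP => // ji.
  by rewrite /s /update gtn_eqF.
have sEM j m : (j < m)%N -> comb_embed m (s j) = comb_embed j.+1 (s j).
  move=> jm; rewrite (comb_embed_widen vp j.+1 m (s j) jm).
  apply: eq_comb_embed => i im; rewrite ltnS; case: leqP => // ji.
  by rewrite /s /update gtn_eqF.
pose a j := comb_embed j.+1 (s j).
have aK : \forall j \near \oo, K (a j).
  exists J => // j /= Jj; apply: dK; rewrite /= metric_sym mdist0E.
  have /andP[_ sd] := sW _ Jj.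
  by rewrite (comb_embed_norm vp sigma_weight)//; move: d_gt0 d_d0 d_eps sd; lra.
have [x [_ clx]] := cK (a @ \oo) _ aK.
have d40 : 0 < d / 4 by rewrite divr_gt0.
(* A cluster point has [a j] within [d / 4] for arbitrarily late [j], hence two such points with
   distinct indices. *)
have near_x L : exists2 j, (maxn J L <= j)%N & mdist x (a j) < d / 4.
  have aL : (a @ \oo) (a @` [set j | (maxn J L <= j)%N]).
    by exists (maxn J L) => // j /= Lj; exists j.
  have [_ [[j Lj <-]]] := clx _ _ aL (nbhsx_ballx x _ d40).
  by rewrite ballEmdist; exists j.
have [i Ji xi] := near_x 0%N.
have [j ij xj] := near_x i.+1.
move: Ji ij; rewrite !geq_max => /andP[Ji _] /andP[Jj ij].
have aij : mdist (a i) (a j) < d / 2.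
  rewrite (le_lt_trans (metric_triangle _ x _))// metric_sym.
  by move: xi xj; lra.
have /andP[_ sid] := sW _ Ji; have /andP[_ sjd] := sW _ Jj.
have ij1 := ltnW (ij : (i.+1 <= j)%N).
have W : weight j.+1 (fun k => s i k - s j k) < eps.
  rewrite (le_lt_trans (weightB vp _ _ _))// sWM// (lt_le_trans _ d_eps)//.
  exact: ltrD.
move: aij; rewrite /a -(sEM i j.+1)// (mdist_comb_embed vp sigma_weight)//.
rewrite ltNge => /negP; apply.
(* Coordinate [i] is [z i] in [s i] and 0 in [s j]; it alone forces a distance above [d / 2]. *)
rewrite (le_trans _ (coord_le_weight vp i j.+1 _ _))//.
rewrite /s update_eq update_lt// subr0.
by have /andP[/ltW] := Hz i.
Qed.

End GlobalTopology.

Theorem theorem5p2 (R : realType) (n : nat) (n_gt0 : (0 < n)%N)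
    (v : nat -> 'rV[R]_n) (p : nat -> R) (vp : is_SNP v p)
    (growth : \forall j \near \oo, 1 <= p j *
       (Num.floor (euclidean_norm (v j.+1) / euclidean_norm (v j) - 1))%:~R) :
  [/\ ind_eq 1 (completion (sigma_seminorm vp)),
      locally_totally_disconnected (completion (sigma_seminorm vp)) &
      ~ locally_compact [set: completion (sigma_seminorm vp)]].
Proof.
(* The growth condition enters through this threshold, below which [sigma] equals the weight. *)
have [eps eps_gt0 sigma_weight] := sigma_small_int_comb vp growth.
split; first split.
- exact: (completion_ind_lt2 vp eps_gt0 sigma_weight).
- exact: (not_completion_ind_lt1 vp eps_gt0 sigma_weight).
- exact: (completion_locally_totally_disconnected vp eps_gt0 sigma_weight).
- exact: (completion_not_locally_compact vp eps_gt0 sigma_weight).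
Qed.
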